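(* Let $f:X\to Y$ be a continuous map between locally compact Hausdorff spaces, let $(A,\rho,\mathbb{B})=(RC(X),\rho_X,CR(X))$, $(B,\eta,\mathbb{B}')=(RC(Y),\rho_Y,CR(Y))$, and let $\varphi=\Lambda^t(f):B\to A$ be given by $\varphi(G)=\mathrm{cl}(f^{-1}(\mathrm{int}(G)))$. Then $f$ is an injection iff $\varphi$ satisfies the following condition: (InHLC) for any $a,b\in\mathbb{B}$ such that $a\,\rho\, b$ fails, there exist $c,d\in\mathbb{B}'$ such that $c\ll_\eta d$, $a\le\varphi(c)$ and $\varphi(d)\,\rho\, b$ fails.
   Context: For a space $X$, $RC(X)$ is the complete Boolean algebra of regular closed subsets of $X$ (those $F$ with $F=\mathrm{cl}(\mathrm{int}(F))$), ordered by inclusion, with $F\vee G=F\cup G$, $F\wedge G=\mathrm{cl}(\mathrm{int}(F\cap G))$, $F^*=\mathrm{cl}(X\setminus F)$; $CR(X)$ is the ideal of compact regular closed subsets; and $F\,\rho_X\,G$ iff $F\cap G\neq\emptyset$. In $(B,\eta,\mathbb{B}')$, $a\ll_\eta b$ means that $a\,\eta\, b^*$ fails; for $B=RC(Y)$ this means $a\subseteq\mathrm{int}(b)$. *)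

(* Defs.v *)
From mathcomp Require Import all_boot all_classical topology.

Set Implicit Arguments.
Unset Strict Implicit.
Unset Printing Implicit Defensive.

Local Open Scope classical_set_scope.

Section RegularClosed.
Variable T : topologicalType.
Implicit Types F G : set T.

Definition RC : set (set T) := [set F | regclosed F].

Definition CR : set (set T) := [set F | RC F /\ compact F].

Definition rc_compl F : set T := closure (~` F).

Definition contact F G : Prop := F `&` G !=set0.

(* The non-tangential inclusion of a contact algebra: F << G iff F is not in
   contact with the complement G^*; llE gives its meaning in RC(T). *)
Definition ll F G : Prop := ~ contact F (rc_compl G).

Lemma llE F G : ll F G <-> F `<=` G°.
Proof.
rewrite /ll /contact /rc_compl closure_setC; split => [H x Fx|FG [x [/FG]]] //.
by apply: contrapT => Gx; apply: H; exists x.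
Qed.

Lemma open_closure_RC (U : set T) : open U -> RC (closure U).
Proof.
move=> oU; apply/seteqP; split.
  rewrite [X in X `<=` _]closureE => x; apply; split;
    [exact: closed_closure | exact: interior_subset].
by apply: closureS; rewrite -open_subsetE //; exact: subset_closure.
Qed.

Lemma rc_compl_RC F : RC F -> RC (rc_compl F).
Proof.
move=> rF; apply: open_closure_RC; rewrite openC -rF; exact: closed_closure.
Qed.

End RegularClosed.

(* Total on sets; it maps RC(Y) into RC(X) for continuous f, by Lambda_t_RC. *)
Definition Lambda_t (X Y : topologicalType) (f : X -> Y) (G : set Y) : set X :=
  closure (f @^-1` (G°)).

Lemma Lambda_t_RC (X Y : topologicalType) (f : X -> Y) (G : set Y) :
  continuous f -> RC (Lambda_t f G).
Proof.
move=> /continuousP cf; apply: open_closure_RC; apply: cf; exact: open_interior.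
Qed.

Definition InHLC (X Y : topologicalType) (phi : set Y -> set X) : Prop :=
  forall a b : set X, CR a -> CR b -> ~ contact a b ->
    exists c d : set Y,
      [/\ CR c, CR d, ll c d, a `<=` phi c & ~ contact (phi d) b].

(* Main.v *)
Require Import Defs.
From mathcomp Require Import all_boot all_classical topology.

(** The condition InHLC says that compact regular closed sets which are disjoint
    in [X] can be separated by regular closed sets pulled back from [Y]. Two
    facts tie it to injectivity.

    - [Lambda_t f G] lies between two honest preimages: it contains
      [f @^-1` G°] and, when [G] is closed, it is contained in [f @^-1` G].
    - In a locally compact Hausdorff space, a compact set [K] inside an open set
      [W] has a compact regular closed neighbourhood inside [W]
      ([CR_nbhs_in_open]).

    If [f] is injective and [a], [b] are disjoint and compact, then [f @` a] and
    [f @` b] are disjoint and compact, hence closed. A neighbourhood [d] of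
    [f @` a] that misses [f @` b], and then a neighbourhood [c] of [f @` a]
    inside [d°], are the sets that InHLC asks for, by the two inclusions above.

    If [f x = f y] with [x <> y], choose disjoint compact regular closed
    neighbourhoods [a] of [x] and [b] of [y] ([CR_separate]). Any [c], [d] as in
    InHLC for [a] and [b] satisfy [f x \in c] and [c `<=` d°], so the common
    value [f y] lies in [d°]; then [y] belongs to both [Lambda_t f d] and [b],
    which are not supposed to meet. *)

Set Implicit Arguments.
Unset Strict Implicit.
Unset Printing Implicit Defensive.

Local Open Scope classical_set_scope.

(** Local compactness only provides one compact neighbourhood of each point; it
    can be shrunk into [W] because a Hausdorff space is regular at every point
    that has a compact neighbourhood. *)
Lemma locally_compact_nbhs_in_open (T : topologicalType) (W : set T) (x : T) :
  hausdorff_space T -> locally_compact [set: T] -> open W -> W x ->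
  exists2 D, compact D /\ D `<=` W & nbhs x D.
Proof.
move=> hT lcT oW Wx.
have [U wU [cU _]] := lcT x I.
have xU : nbhs x U.
  by move: wU; rewrite /within/=; apply: filterS => y; exact.
have [|V xV VW] := compact_regular hT cU xU (t := U `&` W).
  by apply: filterI => //; exact: open_nbhs_nbhs.
exists (closure V); last by apply: filterS xV; exact: subset_closure.
split; last by move=> y /VW[].
by apply: subclosed_compact cU _; [exact: closed_closure|move=> y /VW[]].
Qed.

(** The compact subsets of [W] are directed under inclusion, as they are stable
    by binary union, and every point of [K] is interior to one of them; so
    compactness of [K] yields a single one whose interior covers [K]. *)
Lemma compact_nbhs_in_open (T : topologicalType) (K W : set T) :
  hausdorff_space T -> locally_compact [set: T] ->
  compact K -> open W -> K `<=` W ->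
  exists D, [/\ compact D, D `<=` W & K `<=` D°].
Proof.
move=> hT lcT /compact_near_coveringP cK oW KW.
pose good : set (set T) := [set D | compact D /\ D `<=` W].
pose above (D : set T) := [set E | good E /\ D `<=` E].
(* The filter of eventual properties along the directed family of the good
   sets; along it, the interiors of the good sets increase to cover K. *)
have fF : Filter (filter_from good above).
  apply: filter_from_filter.
    by exists set0; split => //; exact: compact0.
  move=> D E [cD DW] [cE EW]; exists (D `|` E).
    by split; [exact: compactU|rewrite subUset].
  by move=> C [gC]; rewrite subUset => -[].
have [x Kx|D gD DK] := cK _ _ (fun D y => D° y) fF.
  have [D [cD DW] xD] := locally_compact_nbhs_in_open hT lcT oW (KW _ Kx).
  exists (D°, above D); first by split; [exact: nbhs_interior|exists D].
  by move=> [y E] /= [Dy [_ DE]]; exact: interiorS DE _ Dy.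
by exists D; case: (gD) => ? ?; split => //; apply: DK; split.
Qed.

(** The closure of the interior of a compact neighbourhood is regular closed and
    is still a neighbourhood. *)
Lemma CR_nbhs_in_open (T : topologicalType) (K W : set T) :
  hausdorff_space T -> locally_compact [set: T] ->
  compact K -> open W -> K `<=` W ->
  exists D, [/\ CR D, D `<=` W & K `<=` D°].
Proof.
move=> hT lcT cK oW KW.
have [D [cD DW KD]] := compact_nbhs_in_open hT lcT cK oW KW.
have clD : closure D° `<=` D.
  rewrite [X in _ `<=` X](iffLR (closure_id D)); last exact: compact_closed.
  by apply: closureS; exact: interior_subset.
exists (closure D°); split; last 2 first.
- exact: subset_trans clD DW.
- apply: subset_trans KD _; rewrite -open_subsetE; last exact: open_interior.
  exact: subset_closure.
split; first by apply: open_closure_RC; exact: open_interior.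
by apply: subclosed_compact cD clD; exact: closed_closure.
Qed.

(** The second set is chosen inside the complement of the first, which is open
    since compact sets are closed here. *)
Lemma CR_separate (T : topologicalType) (x y : T) :
  hausdorff_space T -> locally_compact [set: T] -> x <> y ->
  exists a b, [/\ CR a, CR b, a x, b y & ~ contact a b].
Proof.
move=> hT lcT xy.
have [||a [ra ay xa]] :=
  @CR_nbhs_in_open _ [set x] (~` [set y]) hT lcT (@compact_set1 _ x).
- by rewrite openC; apply: compact_closed => //; exact: compact_set1.
- by move=> _ ->.
have [||b [rb ba yb]] :=
  @CR_nbhs_in_open _ [set y] (~` a) hT lcT (@compact_set1 _ y).
- by rewrite openC; apply: compact_closed => //; exact: ra.2.
- by move=> _ -> /ay; exact.
exists a, b; split => //.
- by apply: interior_subset; exact: xa.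
- by apply: interior_subset; exact: yb.
- by move=> [z [az /ba]].
Qed.

Section Lambda.
Variables (X Y : topologicalType) (f : X -> Y).

(** Although defined from the interior of [G], [Lambda_t f G] cannot leave the
    preimage of [G], since that preimage is closed. *)
Lemma Lambda_t_sub (G : set Y) :
  continuous f -> closed G -> Lambda_t f G `<=` f @^-1` G.
Proof.
move=> /continuous_closedP cf cG.
rewrite [X in _ `<=` X](iffLR (closure_id _)); last exact: cf.
by apply: closureS => x; exact: interior_subset.
Qed.

Lemma preimage_interior_sub_Lambda_t (G : set Y) :
  f @^-1` G° `<=` Lambda_t f G.
Proof. exact: subset_closure. Qed.

Lemma injective_InHLC :
  hausdorff_space Y -> locally_compact [set: Y] -> continuous f ->
  injective f -> InHLC (Lambda_t f).
Proof.
move=> hY lcY cf injf a b [_ ca] [_ cb] ab.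
have cimg (K : set X) : compact K -> compact (f @` K).
  by apply: continuous_compact; exact: continuous_subspaceT.
have [||d [rd db ad]] :=
  @CR_nbhs_in_open _ (f @` a) (~` (f @` b)) hY lcY (cimg _ ca).
- by rewrite openC; apply: compact_closed => //; exact: cimg.
- move=> _ [x ax <-] [y bty /injf yx].
  by apply: ab; exists x; split => //; rewrite -yx.
have [c [rc cd ac]] :=
  CR_nbhs_in_open hY lcY (cimg _ ca) (@open_interior _ d) ad.
exists c, d; split => //.
- exact/llE.
- by move=> x ax; apply: preimage_interior_sub_Lambda_t; apply: ac; exists x.
- move=> [x [dx bx]].
  have /db : d (f x).
    by apply: Lambda_t_sub dx => //; apply: compact_closed => //; exact: rd.2.
  by apply; exists x.
Qed.

Lemma InHLC_injective :
  hausdorff_space X -> locally_compact [set: X] ->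
  hausdorff_space Y -> continuous f ->
  InHLC (Lambda_t f) -> injective f.
Proof.
move=> hX lcX hY cf H x y fxy; apply: contrapT => xy.
have [a [b [ra rb ax bty ab]]] := CR_separate hX lcX xy.
have [c [d [[_ cc] _ /llE cd ac db]]] := H a b ra rb ab.
apply: db; exists y; split => //.
apply: preimage_interior_sub_Lambda_t; rewrite /preimage/= -fxy; apply: cd.
by apply: Lambda_t_sub (ac _ ax) => //; exact: compact_closed.
Qed.

End Lambda.

Theorem theorem3p16 (X Y : topologicalType) (f : X -> Y)
  (hX : hausdorff_space X) (lcX : locally_compact [set: X])
  (hY : hausdorff_space Y) (lcY : locally_compact [set: Y])
  (cf : continuous f) :
  injective f <-> InHLC (Lambda_t f).
Proof.
by split; [exact: injective_InHLC|exact: InHLC_injective].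
Qed.
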